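(* For a functional PTS specification with EPTS and Dedukti encoding, for all EPTS terms $M,N$: (1) if $M\hookrightarrow N$ then $[\![M]\!]\hookrightarrow^*_{\beta\mathscr R_{EPTS}}[\![N]\!]$; (2) if $M\equiv N$ then $[\![M]\!]\equiv[\![N]\!]$ in Dedukti.
   Context: Functional PTS specification $(\mathcal S,\mathcal A,\mathcal R)$. EPTS terms $x\mid s\mid\Pi_{s_1,s_2}(A,x.B)\mid\lambda_{s_1,s_2}(A,x.B,x.M)\mid@_{s_1,s_2}(A,x.B,M,N)$; EPTS reduction $\hookrightarrow$ is the context closure of $@_{s_1,s_2}(A,x.B,\lambda_{s_1,s_2}(A',x.B',x.M),N)\hookrightarrow M\{N/x\}$ for $(s_1,s_2,s_3)\in\mathcal R$, and $\equiv$ its equivalence. Dedukti theory $(\Sigma_{EPTS},\mathscr R_{EPTS})$: constants $\mathbf U_s$, $\mathbf{El}_s$ ($s\in\mathcal S$), $\mathbf u_{s_1}$ with rule $\mathbf{El}_{s_2}\mathbf u_{s_1}\hookrightarrow\mathbf U_{s_1}$ ($(s_1,s_2)\in\mathcal A$), and for $(s_1,s_2,s_3)\in\mathcal R$ constants $\mathbf{Prod}_{s_1,s_2}$ (arity 2), $\mathbf{abs}_{s_1,s_2}$ (arity 3), $\mathbf{app}_{s_1,s_2}$ (arity 4) with rule $\mathbf{app}_{s_1,s_2}AB(\mathbf{abs}_{s_1,s_2}A'B'M)N\hookrightarrow MN$; Dedukti reduction is $\beta$ together with the context/substitution closure of these rules, $\equiv$ its equivalence. Translation: $[\![x]\!]=x$,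 $[\![s]\!]=\mathbf u_s$, $[\![\Pi_{s_1,s_2}(A,x.B)]\!]=\mathbf{Prod}_{s_1,s_2}[\![A]\!](\lambda x:\mathbf{El}_{s_1}[\![A]\!].[\![B]\!])$, $[\![\lambda_{s_1,s_2}(A,x.B,x.M)]\!]=\mathbf{abs}_{s_1,s_2}[\![A]\!](\lambda x:\mathbf{El}_{s_1}[\![A]\!].[\![B]\!])(\lambda x:\mathbf{El}_{s_1}[\![A]\!].[\![M]\!])$, $[\![@_{s_1,s_2}(A,x.B,M,N)]\!]=\mathbf{app}_{s_1,s_2}[\![A]\!](\lambda x:\mathbf{El}_{s_1}[\![A]\!].[\![B]\!])[\![M]\!][\![N]\!]$. *)

(* Defs.v *)
(** Both calculi are written with de Bruijn indices: in [EProd], [ELam],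
    [EApp], [DPi] and [DLam], the arguments that the informal syntax writes
    [x.B] or [x.M] live under one binder. *)
From Stdlib Require Import Relations Vector.
Import VectorNotations.

Record pts_spec : Type := PTSSpec {
  sort : Type;
  pts_axiom : sort -> sort -> Prop;
  pts_rule : sort -> sort -> sort -> Prop
}.

Definition functional (P : pts_spec) : Prop :=
  (forall s1 s2 s2' : sort P,
      pts_axiom P s1 s2 -> pts_axiom P s1 s2' -> s2 = s2') /\
  (forall s1 s2 s3 s3' : sort P,
      pts_rule P s1 s2 s3 -> pts_rule P s1 s2 s3' -> s3 = s3').

Definition scons {T : Type} (t : T) (f : nat -> T) (x : nat) : T :=
  match x with 0 => t | S y => f y end.

Definition up_ren (xi : nat -> nat) : nat -> nat :=
  scons 0 (fun x => S (xi x)).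

Inductive eterm (Srt : Type) : Type :=
| EVar (x : nat)
| ESort (s : Srt)
| EProd (s1 s2 : Srt) (A B : eterm Srt)
| ELam (s1 s2 : Srt) (A B M : eterm Srt)
| EApp (s1 s2 : Srt) (A B M N : eterm Srt).

Arguments EVar {Srt} x.
Arguments ESort {Srt} s.
Arguments EProd {Srt} s1 s2 A B.
Arguments ELam {Srt} s1 s2 A B M.
Arguments EApp {Srt} s1 s2 A B M N.

Fixpoint erename {Srt : Type} (xi : nat -> nat) (t : eterm Srt) : eterm Srt :=
  match t with
  | EVar x => EVar (xi x)
  | ESort s => ESort s
  | EProd s1 s2 A B => EProd s1 s2 (erename xi A) (erename (up_ren xi) B)
  | ELam s1 s2 A B M =>
      ELam s1 s2 (erename xi A) (erename (up_ren xi) B) (erename (up_ren xi) M)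
  | EApp s1 s2 A B M N =>
      EApp s1 s2 (erename xi A) (erename (up_ren xi) B)
        (erename xi M) (erename xi N)
  end.

Definition eup {Srt : Type} (sigma : nat -> eterm Srt) : nat -> eterm Srt :=
  scons (EVar 0) (fun x => erename S (sigma x)).

Fixpoint esubst {Srt : Type} (sigma : nat -> eterm Srt) (t : eterm Srt)
  : eterm Srt :=
  match t with
  | EVar x => sigma x
  | ESort s => ESort s
  | EProd s1 s2 A B => EProd s1 s2 (esubst sigma A) (esubst (eup sigma) B)
  | ELam s1 s2 A B M =>
      ELam s1 s2 (esubst sigma A) (esubst (eup sigma) B) (esubst (eup sigma) M)
  | EApp s1 s2 A B M N =>
      EApp s1 s2 (esubst sigma A) (esubst (eup sigma) B)
        (esubst sigma M) (esubst sigma N)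
  end.

Definition esubst1 {Srt : Type} (N M : eterm Srt) : eterm Srt :=
  esubst (scons N EVar) M.

Inductive ered (P : pts_spec) : relation (eterm (sort P)) :=
| ered_beta s1 s2 s3 A B A' B' M N :
    pts_rule P s1 s2 s3 ->
    ered P (EApp s1 s2 A B (ELam s1 s2 A' B' M) N) (esubst1 N M)
| ered_prod_A s1 s2 A A' B :
    ered P A A' -> ered P (EProd s1 s2 A B) (EProd s1 s2 A' B)
| ered_prod_B s1 s2 A B B' :
    ered P B B' -> ered P (EProd s1 s2 A B) (EProd s1 s2 A B')
| ered_lam_A s1 s2 A A' B M :
    ered P A A' -> ered P (ELam s1 s2 A B M) (ELam s1 s2 A' B M)
| ered_lam_B s1 s2 A B B' M :
    ered P B B' -> ered P (ELam s1 s2 A B M) (ELam s1 s2 A B' M)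
| ered_lam_M s1 s2 A B M M' :
    ered P M M' -> ered P (ELam s1 s2 A B M) (ELam s1 s2 A B M')
| ered_app_A s1 s2 A A' B M N :
    ered P A A' -> ered P (EApp s1 s2 A B M N) (EApp s1 s2 A' B M N)
| ered_app_B s1 s2 A B B' M N :
    ered P B B' -> ered P (EApp s1 s2 A B M N) (EApp s1 s2 A B' M N)
| ered_app_M s1 s2 A B M M' N :
    ered P M M' -> ered P (EApp s1 s2 A B M N) (EApp s1 s2 A B M' N)
| ered_app_N s1 s2 A B M N N' :
    ered P N N' -> ered P (EApp s1 s2 A B M N) (EApp s1 s2 A B M N').

Definition econv (P : pts_spec) : relation (eterm (sort P)) :=
  clos_refl_sym_trans _ (ered P).

(** Dedukti constants have fixed arities and occur fully applied. *)
Record signature : Type := Signature {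
  const : Type;
  arity : const -> nat
}.

Inductive dterm (Sg : signature) : Type :=
| DVar (x : nat)
| DConst (c : const Sg) (args : Vector.t (dterm Sg) (arity Sg c))
| DType
| DKind
| DPi (A B : dterm Sg)
| DLam (A M : dterm Sg)
| DApp (M N : dterm Sg).

Arguments DVar {Sg} x.
Arguments DConst {Sg} c args.
Arguments DType {Sg}.
Arguments DKind {Sg}.
Arguments DPi {Sg} A B.
Arguments DLam {Sg} A M.
Arguments DApp {Sg} M N.

Fixpoint drename {Sg : signature} (xi : nat -> nat) (t : dterm Sg) : dterm Sg :=
  match t with
  | DVar x => DVar (xi x)
  | DConst c args => DConst c (Vector.map (drename xi) args)
  | DType => DType
  | DKind => DKind
  | DPi A B => DPi (drename xi A) (drename (up_ren xi) B)
  | DLam A M => DLam (drename xi A) (drename (up_ren xi) M)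
  | DApp M N => DApp (drename xi M) (drename xi N)
  end.

Definition dup {Sg : signature} (sigma : nat -> dterm Sg) : nat -> dterm Sg :=
  scons (DVar 0) (fun x => drename S (sigma x)).

Fixpoint dsubst {Sg : signature} (sigma : nat -> dterm Sg) (t : dterm Sg)
  : dterm Sg :=
  match t with
  | DVar x => sigma x
  | DConst c args => DConst c (Vector.map (dsubst sigma) args)
  | DType => DType
  | DKind => DKind
  | DPi A B => DPi (dsubst sigma A) (dsubst (dup sigma) B)
  | DLam A M => DLam (dsubst sigma A) (dsubst (dup sigma) M)
  | DApp M N => DApp (dsubst sigma M) (dsubst sigma N)
  end.

Definition dsubst1 {Sg : signature} (N M : dterm Sg) : dterm Sg :=
  dsubst (scons N DVar) M.

(** [rules l r] says that [l --> r] is a rewrite rule; the free variables of [l]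
    and [r] are the rule's pattern variables. *)
Inductive dred (Sg : signature) (rules : relation (dterm Sg))
  : relation (dterm Sg) :=
| dred_beta A M N : dred Sg rules (DApp (DLam A M) N) (dsubst1 N M)
| dred_rule l r sigma :
    rules l r -> dred Sg rules (dsubst sigma l) (dsubst sigma r)
| dred_const c (args : Vector.t (dterm Sg) (arity Sg c)) i M :
    dred Sg rules (Vector.nth args i) M ->
    dred Sg rules (DConst c args) (DConst c (Vector.replace args i M))
| dred_pi_A A A' B :
    dred Sg rules A A' -> dred Sg rules (DPi A B) (DPi A' B)
| dred_pi_B A B B' :
    dred Sg rules B B' -> dred Sg rules (DPi A B) (DPi A B')
| dred_lam_A A A' M :
    dred Sg rules A A' -> dred Sg rules (DLam A M) (DLam A' M)
| dred_lam_M A M M' :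
    dred Sg rules M M' -> dred Sg rules (DLam A M) (DLam A M')
| dred_app_M M M' N :
    dred Sg rules M M' -> dred Sg rules (DApp M N) (DApp M' N)
| dred_app_N M N N' :
    dred Sg rules N N' -> dred Sg rules (DApp M N) (DApp M N').

Definition dreds (Sg : signature) (rules : relation (dterm Sg))
  : relation (dterm Sg) :=
  clos_refl_trans _ (dred Sg rules).

Definition dconv (Sg : signature) (rules : relation (dterm Sg))
  : relation (dterm Sg) :=
  clos_refl_sym_trans _ (dred Sg rules).

(** A name exists for every sort or pair of sorts, so that raw terms such as the
    translation of a sort with no axiom make sense; the side conditions on
    [pts_axiom] and [pts_rule] are carried by the rewrite rules. *)
Inductive epts_const (Srt : Type) : Type :=
| cU (s : Srt)
| cEl (s : Srt)
| cu (s : Srt)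
| cProd (s1 s2 : Srt)
| cabs (s1 s2 : Srt)
| capp (s1 s2 : Srt).

Arguments cU {Srt} s.
Arguments cEl {Srt} s.
Arguments cu {Srt} s.
Arguments cProd {Srt} s1 s2.
Arguments cabs {Srt} s1 s2.
Arguments capp {Srt} s1 s2.

Definition epts_arity {Srt : Type} (c : epts_const Srt) : nat :=
  match c with
  | cU _ => 0
  | cEl _ => 1
  | cu _ => 0
  | cProd _ _ => 2
  | cabs _ _ => 3
  | capp _ _ => 4
  end.

Definition epts_sig (Srt : Type) : signature :=
  Signature (epts_const Srt) epts_arity.

Section Constants.
Context {Srt : Type}.
Implicit Types (s : Srt) (A B M N : dterm (epts_sig Srt)).

Definition dU s : dterm (epts_sig Srt) :=
  @DConst (epts_sig Srt) (cU s) [].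
Definition dEl s A : dterm (epts_sig Srt) :=
  @DConst (epts_sig Srt) (cEl s) [A].
Definition du s : dterm (epts_sig Srt) :=
  @DConst (epts_sig Srt) (cu s) [].
Definition dProd s1 s2 A B : dterm (epts_sig Srt) :=
  @DConst (epts_sig Srt) (cProd s1 s2) [A; B].
Definition dabs s1 s2 A B M : dterm (epts_sig Srt) :=
  @DConst (epts_sig Srt) (cabs s1 s2) [A; B; M].
Definition dapp s1 s2 A B M N : dterm (epts_sig Srt) :=
  @DConst (epts_sig Srt) (capp s1 s2) [A; B; M; N].
End Constants.

(** In [rule_app] the pattern variables [A, B, A', B', M, N] are the indices
    [0, 1, 2, 3, 4, 5]. *)
Inductive epts_rules (P : pts_spec) : relation (dterm (epts_sig (sort P))) :=
| rule_El s1 s2 :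
    pts_axiom P s1 s2 -> epts_rules P (dEl s2 (du s1)) (dU s1)
| rule_app s1 s2 s3 :
    pts_rule P s1 s2 s3 ->
    epts_rules P
      (dapp s1 s2 (DVar 0) (DVar 1)
         (dabs s1 s2 (DVar 2) (DVar 3) (DVar 4)) (DVar 5))
      (DApp (DVar 4) (DVar 5)).

Fixpoint trans {Srt : Type} (t : eterm Srt) : dterm (epts_sig Srt) :=
  match t with
  | EVar x => DVar x
  | ESort s => du s
  | EProd s1 s2 A B =>
      dProd s1 s2 (trans A) (DLam (dEl s1 (trans A)) (trans B))
  | ELam s1 s2 A B M =>
      dabs s1 s2 (trans A) (DLam (dEl s1 (trans A)) (trans B))
        (DLam (dEl s1 (trans A)) (trans M))
  | EApp s1 s2 A B M N =>
      dapp s1 s2 (trans A) (DLam (dEl s1 (trans A)) (trans B))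
        (trans M) (trans N)
  end.

(* Main.v *)
(** The translation commutes with renaming and substitution. An EPTS beta step
    is therefore simulated by two Dedukti steps: the rule for [capp], whose
    right-hand side is the application of a translated abstraction to its
    argument, followed by a beta step. The translation copies [A] into the
    domain annotations of the abstractions, so a step inside [A] is simulated by
    several steps, one for each copy; this is why (1) is stated with the
    reflexive transitive closure. *)
Require Import Defs.
From Stdlib Require Import Relations Vector.
Import VectorNotations.

Lemma clos_rt_map {T U : Type} (R : relation T) (Q : relation U) (f : T -> U) :
  (forall x y, R x y -> Q (f x) (f y)) ->
  forall x y, clos_refl_trans _ R x y -> clos_refl_trans _ Q (f x) (f y).
Proof.
  intros Hf x y H; induction H as [x y H | x | x y z _ IH1 _ IH2].
  - apply rt_step, Hf, H.
  - apply rt_refl.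
  - eapply rt_trans; [exact IH1 | exact IH2].
Qed.

Section Substitution.
Context {Srt : Type}.
Implicit Types t : eterm Srt.

(** Each copied annotation [dEl s1 (trans A)] lies outside the binder it annotates, so all copies of
    [A] are renamed by the same [xi], and both calculi lift [xi] by the same [up_ren]. *)
Lemma trans_erename t (xi : nat -> nat) :
  trans (erename xi t) = drename xi (trans t).
Proof.
  revert xi; induction t; intros xi; cbn;
    repeat match goal with
    | IH : forall xi, trans (erename xi ?u) = _
      |- context [trans (erename _ ?u)] => rewrite IH
    end; reflexivity.
Qed.

Lemma trans_eup (sigma : nat -> eterm Srt) tau :
  (forall x, trans (sigma x) = tau x) ->
  forall x, trans (eup sigma x) = dup tau x.
Proof.
  intros H [|x]; cbn; [reflexivity | now rewrite trans_erename, H].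
Qed.

(** Relating [sigma] and [tau] pointwise lets the induction pass under binders without functional
    extensionality: the lifted substitutions agree only pointwise. *)
Lemma trans_esubst t (sigma : nat -> eterm Srt) tau :
  (forall x, trans (sigma x) = tau x) ->
  trans (esubst sigma t) = dsubst tau (trans t).
Proof.
  revert sigma tau; induction t; intros sigma tau H; cbn;
    repeat match goal with
    | IH : forall sigma tau, _ -> trans (esubst sigma ?u) = _
      |- context [trans (esubst sigma ?u)] => rewrite (IH _ tau H)
    | IH : forall sigma tau, _ -> trans (esubst sigma ?u) = _
      |- context [trans (esubst (eup sigma) ?u)] =>
        rewrite (IH _ (dup tau) (trans_eup _ _ H))
    end; auto.
Qed.

Lemma trans_esubst1 (M N : eterm Srt) :
  trans (esubst1 N M) = dsubst1 (trans N) (trans M).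
Proof.
  apply trans_esubst; intros [|x]; reflexivity.
Qed.

End Substitution.

Section Congruence.
Context {Srt : Type} (rules : relation (dterm (epts_sig Srt))).
Notation "M '-->*' N" := (dreds (epts_sig Srt) rules M N) (at level 70).
Implicit Types (s : Srt) (A B M N : dterm (epts_sig Srt)).

Lemma dreds_DLam A A' M M' : A -->* A' -> M -->* M' -> DLam A M -->* DLam A' M'.
Proof.
  intros HA HM; apply rt_trans with (DLam A' M).
  - refine (clos_rt_map _ _ (fun x => DLam x M) _ _ _ HA).
    intros; now apply dred_lam_A.
  - refine (clos_rt_map _ _ (DLam A') _ _ _ HM).
    intros; now apply dred_lam_M.
Qed.

Lemma dreds_dEl s A A' : A -->* A' -> dEl s A -->* dEl s A'.
Proof.
  apply (clos_rt_map _ _ (dEl s)); intros x y H.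
  (* On a literal vector and position, [Vector.nth] and [Vector.replace] compute, so this instance
     is the goal up to conversion. *)
  exact (dred_const (epts_sig Srt) _ (cEl s) [x] Fin.F1 y H).
Qed.

Lemma dreds_dProd s1 s2 A A' B B' :
  A -->* A' -> B -->* B' -> dProd s1 s2 A B -->* dProd s1 s2 A' B'.
Proof.
  intros HA HB; apply rt_trans with (dProd s1 s2 A' B).
  - refine (clos_rt_map _ _ (fun x => dProd s1 s2 x B) _ _ _ HA).
    intros x y H; exact (dred_const (epts_sig Srt) _ (cProd s1 s2) [x; B] Fin.F1 y H).
  - refine (clos_rt_map _ _ (dProd s1 s2 A') _ _ _ HB).
    intros x y H.
    exact (dred_const (epts_sig Srt) _ (cProd s1 s2) [A'; x] (Fin.FS Fin.F1) y H).
Qed.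

Lemma dreds_dabs s1 s2 A A' B B' M M' :
  A -->* A' -> B -->* B' -> M -->* M' ->
  dabs s1 s2 A B M -->* dabs s1 s2 A' B' M'.
Proof.
  intros HA HB HM; apply rt_trans with (dabs s1 s2 A' B M);
    [|apply rt_trans with (dabs s1 s2 A' B' M)].
  - refine (clos_rt_map _ _ (fun x => dabs s1 s2 x B M) _ _ _ HA).
    intros x y H; exact (dred_const (epts_sig Srt) _ (cabs s1 s2) [x; B; M] Fin.F1 y H).
  - refine (clos_rt_map _ _ (fun x => dabs s1 s2 A' x M) _ _ _ HB).
    intros x y H.
    exact (dred_const (epts_sig Srt) _ (cabs s1 s2) [A'; x; M] (Fin.FS Fin.F1) y H).
  - refine (clos_rt_map _ _ (dabs s1 s2 A' B') _ _ _ HM).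
    intros x y H.
    exact (dred_const (epts_sig Srt) _ (cabs s1 s2) [A'; B'; x] (Fin.FS (Fin.FS Fin.F1)) y H).
Qed.

(** The arguments are reduced one at a time, from left to right; the intermediate terms mix reduced
    and unreduced arguments. *)
Lemma dreds_dapp s1 s2 A A' B B' M M' N N' :
  A -->* A' -> B -->* B' -> M -->* M' -> N -->* N' ->
  dapp s1 s2 A B M N -->* dapp s1 s2 A' B' M' N'.
Proof.
  intros HA HB HM HN; apply rt_trans with (dapp s1 s2 A' B M N);
    [|apply rt_trans with (dapp s1 s2 A' B' M N);
      [|apply rt_trans with (dapp s1 s2 A' B' M' N)]].
  - refine (clos_rt_map _ _ (fun x => dapp s1 s2 x B M N) _ _ _ HA).
    intros x y H; exact (dred_const (epts_sig Srt) _ (capp s1 s2) [x; B; M; N] Fin.F1 y H).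
  - refine (clos_rt_map _ _ (fun x => dapp s1 s2 A' x M N) _ _ _ HB).
    intros x y H.
    exact (dred_const (epts_sig Srt) _ (capp s1 s2) [A'; x; M; N] (Fin.FS Fin.F1) y H).
  - refine (clos_rt_map _ _ (fun x => dapp s1 s2 A' B' x N) _ _ _ HM).
    intros x y H.
    exact (dred_const (epts_sig Srt) _ (capp s1 s2) [A'; B'; x; N]
             (Fin.FS (Fin.FS Fin.F1)) y H).
  - refine (clos_rt_map _ _ (dapp s1 s2 A' B' M') _ _ _ HN).
    intros x y H.
    exact (dred_const (epts_sig Srt) _ (capp s1 s2) [A'; B'; M'; x]
             (Fin.FS (Fin.FS (Fin.FS Fin.F1))) y H).
Qed.

End Congruence.

Lemma dred_dapp_dabs (P : pts_spec) s1 s2 s3 A B A' B' M N :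
  pts_rule P s1 s2 s3 ->
  dred (epts_sig (sort P)) (epts_rules P)
    (dapp s1 s2 A B (dabs s1 s2 A' B' M) N) (DApp M N).
Proof.
  intros H.
  (* The substitution lists the values of the pattern variables 0 to 5; its tail [DVar] is never
     reached by the rule. *)
  exact (dred_rule _ _ _ _
           (scons A (scons B (scons A' (scons B' (scons M (scons N DVar))))))
           (rule_app P s1 s2 s3 H)).
Qed.

Lemma trans_ered (P : pts_spec) (M N : eterm (sort P)) :
  ered P M N -> dreds (epts_sig (sort P)) (epts_rules P) (trans M) (trans N).
Proof.
  induction 1 as [s1 s2 s3 A B A' B' M N Hr | | | | | | | | |]; cbn [trans].
  1: { eapply rt_trans; apply rt_step.
       - apply (dred_dapp_dabs P s1 s2 s3); exact Hr.
       (* The beta step discards the domain annotation, which comes from [A'] and need not match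
          [A]. *)
       - rewrite trans_esubst1; apply dred_beta. }
  (* Congruence cases: the goal is split down to the copies of the subterms; the induction
     hypothesis closes the changed ones and reflexivity the others. *)
  all: repeat first
    [ assumption | apply rt_refl | apply dreds_dProd | apply dreds_dabs
    | apply dreds_dapp | apply dreds_DLam | apply dreds_dEl ].
Qed.

Theorem mainTheorem10 (P : pts_spec) (HP : functional P)
    (M N : eterm (sort P)) :
  (ered P M N ->
     dreds (epts_sig (sort P)) (epts_rules P) (trans M) (trans N)) /\
  (econv P M N ->
     dconv (epts_sig (sort P)) (epts_rules P) (trans M) (trans N)).
Proof.
  split; [apply trans_ered |].
  intros H; induction H as [M N H | M | M N _ IH | M N L _ IH1 _ IH2].
  (* A generating step becomes a reduction sequence by (1), which is in particular a conversion. *)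
  - now apply clos_rt_clos_rst, trans_ered.
  - apply rst_refl.
  - now apply rst_sym.
  - eapply rst_trans; [exact IH1 | exact IH2].
Qed.
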